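(* Suppose that $(A,\alpha,\mathcal{L})$ is an Exel system. For any representation $(\pi,S)$ of $(A,\mathcal{L})$ we automatically have $$S\pi(a)=\pi(\alpha(a))S,\qquad a\in A.$$ Thus the classes of representations of $(A,\mathcal{L})$ and $(A,\alpha,\mathcal{L})$ coincide and $$\mathcal{T}(A,\mathcal{L})=\mathcal{T}(A,\alpha,\mathcal{L}).$$ Moreover, the notions of redundancy for $(\pi,S)$ as a representation of $(A,\mathcal{L})$ and as a representation of $(A,\alpha,\mathcal{L})$ coincide.
   Context: An Exel system $(A,\alpha,\mathcal{L})$ consists of a $C^*$-algebra $A$, an endomorphism $\alpha:A\to A$ and a positive linear map $\mathcal{L}:A\to A$ with $\mathcal{L}(a\alpha(b))=\mathcal{L}(a)b$ for all $a,b\in A$ (then $\mathcal{L}$ is automatically completely positive). $\overline{XYZ}$ denotes the closed linear span of products. A representation of $(A,\mathcal{L})$ is a pair $(\pi,S)$ consisting of a non-degenerate representation $\pi:A\to B(H)$ and $S\in B(H)$ with $S^*\pi(a)S=\pi(\mathcal{L}(a))$ for all $a\in A$. Its redundancies are the pairs $(\pi(a),k)$ with $a\in A$, $k\in\overline{\pi(A)S\pi(A)S^*\pi(A)}$ and $\pi(a)\pi(b)S=k\pi(b)S$ for all $b\in A$. $\mathcal{T}(A,\mathcal{L})$ is the $C^*$-algebra generated by $i_A(A)\cup i_A(A)t$ for the universal representation $(i_A,t)$ of $(A,\mathcal{L})$. A representation of $(A,\alpha,\mathcal{L})$ is a pair $(\pi,S)$ consisting of a non-degenerate representation $\pi:A\to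 B(H)$ and $S\in B(H)$ with $S\pi(a)=\pi(\alpha(a))S$ and $S^*\pi(a)S=\pi(\mathcal{L}(a))$ for all $a\in A$. Its redundancies are the pairs $(\pi(a),k)$ with $a\in A$, $k\in\overline{\pi(A)SS^*\pi(A)}$ and $\pi(a)\pi(b)S=k\pi(b)S$ for all $b\in A$. $\mathcal{T}(A,\alpha,\mathcal{L})$ is the $C^*$-algebra generated by $i_A(A)\cup i_A(A)t$ for the universal representation $(i_A,t)$ of $(A,\alpha,\mathcal{L})$. *)

(* Defs.v *)
From HB Require Import structures.
From mathcomp Require Import all_boot all_order all_algebra.
From mathcomp Require Import ring.
From mathcomp Require Import sesquilinear complex.
From mathcomp Require Import all_classical all_reals.
From mathcomp Require Import topology normedtype.

Set Implicit Arguments.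
Unset Strict Implicit.
Unset Printing Implicit Defensive.

Import Order.TTheory GRing.Theory Num.Theory.
Import Num.Def.
Local Open Scope classical_set_scope.
Local Open Scope ring_scope.
Local Open Scope complex_scope.

(* C*-algebras are complex and not assumed unital; norms take values in R[i],
   as for every normedModType over R[i] *)
HB.mixin Record CompleteNormedModule_isCStarAlgebra (R : realType) A
    of CompleteNormedModule R[i] A := {
  cmul : A -> A -> A ;
  star : A -> A ;
  cmulA : associative cmul ;
  cmulDl : left_distributive cmul +%R ;
  cmulDr : right_distributive cmul +%R ;
  cmulZl : forall (k : R[i]) a b, cmul (k *: a) b = k *: cmul a b ;
  cmulZr : forall (k : R[i]) a b, cmul a (k *: b) = k *: cmul a b ;
  starK : involutive star ;
  starD : {morph star : a b / a + b} ;
  starZ : forall (k : R[i]) a, star (k *: a) = conjC k *: star a ;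
  starM : forall a b, star (cmul a b) = cmul (star b) (star a) ;
  ler_cnormM : forall a b : A, `|cmul a b| <= `|a| * `|b| ;
  cstar_identity : forall a : A, `|cmul (star a) a| = `|a| ^+ 2
}.

#[short(type="cstarAlgType")]
HB.structure Definition CStarAlgebra (R : realType) :=
  {A of CompleteNormedModule R[i] A & CompleteNormedModule_isCStarAlgebra R A}.

(* the inner product is linear in its first argument *)
HB.mixin Record CompleteNormedModule_isHilbert (R : realType) H
    of CompleteNormedModule R[i] H := {
  inner : {dot H for (@conjC R[i])} ;
  normr_inner : forall x : H, `|x| ^+ 2 = inner x x
}.

#[short(type="hilbertType")]
HB.structure Definition Hilbert (R : realType) :=
  {H of CompleteNormedModule R[i] H & CompleteNormedModule_isHilbert R H}.

Infix "**" := cmul (at level 40, left associativity) : ring_scope.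


Section inner_theory.
Context {R : realType} {H : hilbertType R}.
Implicit Types x y z : H.

Lemma innerDl x y z : inner (x + y) z = inner x z + inner y z.
Proof. exact: linearDl. Qed.
Lemma innerDr x y z : inner x (y + z) = inner x y + inner x z.
Proof. exact: linearDr. Qed.
Lemma innerZl k x y : inner (k *: x) y = k * inner x y.
Proof. exact: linearZl_LR. Qed.
Lemma innerZr k x y : inner x (k *: y) = conjC k * inner x y.
Proof. exact: linearZr_LR. Qed.
Lemma innerC x y : inner x y = conjC (inner y x).
Proof. by rewrite (hermC inner) expr0 mul1r. Qed.
Lemma innerNl x y : inner (- x) y = - inner x y.
Proof. by rewrite -scaleN1r innerZl mulN1r. Qed.
Lemma innerNr x y : inner x (- y) = - inner x y.
Proof. by rewrite -scaleN1r innerZr rmorphN1 mulN1r. Qed.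
Lemma inner0l x : inner 0 x = 0.
Proof. by rewrite -(scale0r (0 : H)) innerZl mul0r. Qed.
Lemma inner0r x : inner x 0 = 0.
Proof. by rewrite innerC inner0l rmorph0. Qed.
Lemma inner_ext x y : (forall z, inner x z = inner y z) -> x = y.
Proof.
move=> h; apply/eqP; rewrite -subr_eq0 -normr_eq0 -sqrf_eq0 normr_inner.
by rewrite innerDl innerNl h subrr.
Qed.

Lemma inner_le x y : `|inner x y| <= `|x| * `|y|.
Proof.
have [->|y0] := eqVneq y 0.
  by rewrite inner0r normr0 mulr_ge0.
set a := inner x y / `|y| ^+ 2.
have y2 : `|y| ^+ 2 != 0 by rewrite sqrf_eq0 normr_eq0.
have : 0 <= `|x - a *: y| ^+ 2 by rewrite exprn_ge0.
rewrite normr_inner !(innerDl, innerDr, innerNl, innerNr, innerZl, innerZr) -!normr_inner.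
rewrite (innerC y x).
have aE : a * `|y| ^+ 2 = inner x y by rewrite /a divfK.
rewrite opprK (mulrC (conjC a) (`|y|^+2)) mulrA aE (mulrC (inner x y)) (addrC (- _)) addrA subrK.
rewrite subr_ge0 /a mulrAC -normCK -(ler_pM2r (x := `|y| ^+ 2)); last first.
  by rewrite exprn_gt0 // normr_gt0.
rewrite divfK // -exprMn => h.
by rewrite -(ler_pXn2r (n := 2)) // ?nnegrE ?mulr_ge0.
Qed.
End inner_theory.

Section riesz.
Context {R : realType}.
Local Notation C := R[i].

Lemma cinf_exists (P : set C) : P !=set0 -> (forall r, P r -> 0 <= r) ->
  exists d : C, [/\ 0 <= d, forall r, P r -> d <= r &
    forall e, 0 < e -> exists2 r, P r & r < d + e].
Proof.
move=> [r0 Pr0] P0; pose S := [set r : R | P r%:C].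
have PS r : P r -> S (complex.Re r) by move=> Pr; rewrite /S /= RRe_real // ger0_real // P0.
have S0 : S !=set0 by exists (complex.Re r0); exact: PS.
have lbS : lbound S 0 by move=> r /P0; rewrite lecR.
have hS : has_inf S by split => //; exists 0.
exists (inf S)%:C; split.
- by rewrite lecR; exact: lb_le_inf.
- move=> r Pr; rewrite -(RRe_real (ger0_real (P0 _ Pr))) lecR.
  by apply: ge_inf; [exists 0 | exact: PS].
- move=> e e0; have eR : 0 < complex.Re e by rewrite -ltcR RRe_real // gtr0_real.
  have [r Sr rlt] := inf_adherent eR hS.
  exists r%:C => //; rewrite -(RRe_real (gtr0_real e0)).
  by rewrite -rmorphD /= ltcR.
Qed.

Context {H : hilbertType R}.
Implicit Types x y z : H.

Lemma parallelogram x y :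
  `|x - y| ^+ 2 + `|x + y| ^+ 2 = (`|x| ^+ 2 + `|y| ^+ 2) *+ 2.
Proof.
rewrite !normr_inner !(innerDl, innerDr, innerNl, innerNr) opprK.
ring.
Qed.

Lemma riesz (f : H -> C) (M : C) : (forall k x y, f (k *: x + y) = k * f x + f y) ->
  (forall x, `|f x| <= M * `|x|) -> exists y, forall x, f x = inner x y.
Proof.
move=> fl fM.
have f0 : f 0 = 0.
  by have := fl (-1) 0 0; rewrite scaler0 addr0 mulN1r addNr.
have fD x y : f (x + y) = f x + f y by rewrite -[x]scale1r fl mul1r scale1r.
have fZ k x : f (k *: x) = k * f x by rewrite -[_ *: _]addr0 fl f0 addr0.
have fN x : f (- x) = - f x by rewrite -scaleN1r fZ mulN1r.
have [f00|] := pselect (forall x, f x = 0).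
  by exists 0 => x; rewrite f00 inner0r.
move/existsNP => [z0 /eqP fz0].
have [z fz] : exists z, f z = 1 by exists ((f z0)^-1 *: z0); rewrite fZ mulVf.
have [||d [d0 dle dapp]] := @cinf_exists [set r | exists2 x, f x = 1 & r = `|x| ^+ 2].
- by exists (`|z| ^+ 2), z.
- by move=> r [x _ ->]; rewrite exprn_ge0.
pose E e := [set x | f x = 1 /\ `|x| ^+ 2 < d + e].
have E0 e : 0 < e -> exists x, E e x.
  by move=> /dapp[r [x fx ->] h]; exists x.
have Ecl e x y : E e x -> E e y -> `|x - y| ^+ 2 < e *+ 4.
  move=> [fx xe] [fy ye].
  have h : d *+ 4 <= `|x + y| ^+ 2.
    have := dle (`|2^-1 *: (x + y)| ^+ 2) _.
    have -> : `|2^-1 *: (x + y)| ^+ 2 = `|x + y| ^+ 2 / 4.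
      rewrite normrZ exprMn mulrC normfV normr_nat exprVn -natrX //.
    rewrite ler_pdivlMr ?ltr0n // mulr_natr; apply.
    exists (2^-1 *: (x + y)) => //; last by rewrite normrZ exprMn mulrC normfV normr_nat exprVn -natrX.
    by rewrite fZ fD fx fy -mulr2n -mulr_natr mul1r mulVf // pnatr_eq0.
  have := parallelogram x y => /(canRL (addrK _)) ->.
  rewrite ltrBlDr (lt_le_trans (y := (d + e + (d + e)) *+ 2)) //.
    by rewrite ltrMn2r ltrD.
  have -> : (d + e + (d + e)) *+ 2 = e *+ 4 + d *+ 4 by ring.
  by rewrite lerD2l.
pose F := filter_from [set e : C | 0 < e] E.
have FF : ProperFilter F.
  apply: filter_from_proper => [|e /= e0]; last exact: E0.
  apply: filter_from_filter; first by exists 1 => /=.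
  move=> a b a0 b0; have [ab|ba] := real_leP (gtr0_real a0) (gtr0_real b0).
  - exists a => // x [fx xa]; split; split => //.
    by rewrite (lt_le_trans xa) // lerD2l.
  - exists b => // x [fx xb]; split; split => //.
    by rewrite (lt_trans xb) // ltrD2l.
have Fc : cauchy F.
  apply: cauchy_exP => e e0.
  have e4 : 0 < e ^+ 2 / 4 by rewrite divr_gt0 ?exprn_gt0 ?ltr0n.
  have [x xE] := E0 _ e4; exists x; exists (e ^+ 2 / 4) => // y yE.
  rewrite -ball_normE /ball_ /= -(ltr_pXn2r (n := 2)) // ?nnegrE ?(ltW e0) //.
  by have := Ecl _ _ _ xE yE; rewrite -[X in _ < X]mulr_natr divfK // pnatr_eq0.
have [l Fl] : exists l : H, F --> l by exists (lim F); have := @cauchy_cvg H F FF Fc; done.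
have app a e : 0 < a -> 0 < e -> exists x, E a x /\ `|l - x| < e.
  move=> a0 e0; have FE : F (E a) by exists a.
  have Fb : F (ball l e) by apply: Fl; exact: nbhsx_ballx.
  have [x [/= ? ]] := filter_ex (filterI FE Fb).
  by rewrite -ball_normE /ball_ /= => ?; exists x.

have small (u : C) (B : C) : 0 <= B -> (forall e, 0 < e -> `|u| <= e * B) -> u = 0.
  move=> B0 h; apply/eqP; rewrite -normr_le0; apply/ler_addgt0Pr => e e0.
  rewrite add0r; have B1 : 0 < B + 1 by rewrite ltr_wpDl.
  have := h (e / (B + 1)); rewrite divr_gt0 // => /(_ isT) /le_trans; apply.
  rewrite -mulrA ger_pMr // mulrC ler_pdivrMr // mul1r lerDl //.
have M0 : 0 <= M.
  have : 0 <= M * `|z| by rewrite (le_trans _ (fM z)).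
  have z0' : 0 < `|z|.
    rewrite normr_gt0; apply/eqP => zz; move: fz; rewrite zz f0 => /eqP.
    by rewrite eq_sym oner_eq0.
  by rewrite pmulr_lge0.
have fl1 : f l = 1.
  apply/eqP; rewrite -subr_eq0; apply/eqP; apply: (small _ M M0) => e e0.
  have [x [[fx _] xl]] := app 1 e ltr01 e0.
  rewrite -fx -fN -fD (le_trans (fM _)) // mulrC ler_wpM2r // ltW //.
have lker k : f k = 0 -> inner l k = 0.
  move=> fk; apply: (small _ (`|k| *+ 2)); first by rewrite mulrn_wge0.
  move=> e e0; have [x [[fx xE] xl]] := app _ _ (exprn_gt0 2 e0) e0.

  have xk : `|inner x k| <= e * `|k|.
    have [->|k0] := eqVneq k 0; first by rewrite inner0r !normr0 mulr0.
    have k2 : 0 < `|k| ^+ 2 by rewrite exprn_gt0 // normr_gt0.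
    pose c := inner x k / `|k| ^+ 2.
    have : d <= `|x - c *: k| ^+ 2.
      by apply: dle; exists (x - c *: k) => //; rewrite fD fN fZ fk mulr0 subr0.
    have cE : c * `|k| ^+ 2 = inner x k by rewrite /c divfK // gt_eqF.
    rewrite normr_inner !(innerDl, innerDr, innerNl, innerNr, innerZl, innerZr) -!normr_inner.
    rewrite (innerC k x) opprK (mulrC (conjC c) (`|k| ^+ 2)) mulrA cE.
    rewrite (mulrC (inner x k)) (addrC (- _)) addrA subrK /c mulrAC -normCK => h.
    have {}h : `|inner x k| ^+ 2 / `|k| ^+ 2 < (e ^+ 2).
      by move: h; rewrite lerBrDr => /le_lt_trans /(_ xE); rewrite ltrD2l.
    rewrite -(ler_pXn2r (n := 2)) // ?nnegrE ?mulr_ge0 ?(ltW e0) // exprMn.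
    by rewrite -ler_pdivrMr // ltW.
  have -> : inner l k = inner (l - x) k + inner x k by rewrite innerDl innerNl subrK.
  rewrite mulr2n mulrDr (le_trans (ler_normD _ _)) // lerD //.
  by rewrite (le_trans (inner_le _ _)) // ler_wpM2r // ltW.
have l0 : `|l| ^+ 2 != 0.
  rewrite sqrf_eq0 normr_eq0; apply/eqP => l0; move: fl1; rewrite l0 f0 => /eqP.
  by rewrite eq_sym oner_eq0.
exists ((`|l| ^+ 2)^-1 *: l) => x; rewrite innerZr.
have -> : inner x l = f x * `|l| ^+ 2.
  have : inner l (x - f x *: l) = 0.
    by apply: lker; rewrite fD fN fZ fl1 mulr1 subrr.
  move/(congr1 conjC); rewrite -innerC innerDl innerNl innerZl -normr_inner rmorph0.
  by move/eqP; rewrite subr_eq0 => /eqP.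
have -> : conjC (`|l| ^+ 2)^-1 = (`|l| ^+ 2)^-1.
  by apply: geC0_conj; rewrite invr_ge0 exprn_ge0.
by rewrite mulrC -mulrA mulfV // mulr1.
Qed.
End riesz.

(* B(H) *)
Record bop (R : realType) (H : hilbertType R) := Bop {
  bop_fun :> H -> H ;
  bop_linearP : linear bop_fun ;
  bop_boundedP : exists M : R[i], forall x, `|bop_fun x| <= M * `|x|
}.

Section bop_theory.
Context {R : realType} {H : hilbertType R}.
Local Notation C := R[i].
Local Notation B := (bop H).
Implicit Types (S T : B) (x y : H) (k : C).

Lemma bop_ext S T : (forall x, S x = T x) -> S = T.
Proof.
case: S T => [f fl fb] [g gl gb] /= /funext fg; subst g.
by congr Bop; exact: Prop_irrelevance.
Qed.

HB.instance Definition _ T := GRing.isLinear.Build C H H *:%R T (@bop_linearP R H T).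

Lemma bop_bound T : exists2 M : C, 0 <= M & forall x, `|T x| <= M * `|x|.
Proof.
have [M hM] := bop_boundedP T.
have [[z z0]|nz] := pselect (exists z : H, z != 0).
  exists M => //; have z0' : 0 < `|z| by rewrite normr_gt0.
  by rewrite -(pmulr_lge0 _ z0') (le_trans _ (hM z)).
exists 0 => // x; have [->|x0] := eqVneq x 0; first by rewrite linear0 normr0 mul0r.
by exfalso; apply: nz; exists x.
Qed.

Fact bop_zero_linear : linear (fun _ : H => 0 : H).
Proof. by move=> k x y; rewrite scaler0 addr0. Qed.
Fact bop_zero_bounded : exists M : C, forall x, `|(0 : H)| <= M * `|x|.
Proof. by exists 0 => x; rewrite mul0r normr0. Qed.
Definition bop_zero : B := Bop bop_zero_linear bop_zero_bounded.

Fact bop_opp_linear T : linear (fun x => - T x).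
Proof. by move=> k x y; rewrite linearP opprD scalerN. Qed.
Fact bop_opp_bounded T : exists M : C, forall x, `|- T x| <= M * `|x|.
Proof. by have [M _ h] := bop_bound T; exists M => x; rewrite normrN. Qed.
Definition bop_opp T : B := Bop (bop_opp_linear T) (bop_opp_bounded T).

Fact bop_add_linear S T : linear (fun x => S x + T x).
Proof. by move=> k x y; rewrite !linearP addrACA scalerDr. Qed.
Fact bop_add_bounded S T : exists M : C, forall x, `|S x + T x| <= M * `|x|.
Proof.
have [M _ hS] := bop_bound S; have [N _ hT] := bop_bound T.
by exists (M + N) => x; rewrite mulrDl (le_trans (ler_normD _ _)) // lerD.
Qed.
Definition bop_add S T : B := Bop (bop_add_linear S T) (bop_add_bounded S T).

Fact bop_scale_linear k T : linear (fun x => k *: T x).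
Proof. by move=> l x y; rewrite linearP scalerDr !scalerA mulrC. Qed.
Fact bop_scale_bounded k T : exists M : C, forall x, `|k *: T x| <= M * `|x|.
Proof.
have [M _ h] := bop_bound T; exists (`|k| * M) => x.
by rewrite normrZ -mulrA ler_wpM2l.
Qed.
Definition bop_scale k T : B := Bop (bop_scale_linear k T) (bop_scale_bounded k T).

Fact bop_comp_linear S T : linear (fun x => S (T x)).
Proof. by move=> k x y; rewrite !linearP. Qed.
Fact bop_comp_bounded S T : exists M : C, forall x, `|S (T x)| <= M * `|x|.
Proof.
have [M M0 hS] := bop_bound S; have [N _ hT] := bop_bound T.
exists (M * N) => x; rewrite (le_trans (hS _)) // -mulrA ler_wpM2l //.
Qed.
Definition bop_comp S T : B := Bop (bop_comp_linear S T) (bop_comp_bounded S T).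

Lemma bop_adjoint_exists T :
  exists S : B, forall x y, inner (T x) y = inner x (S y).
Proof.
have [M M0 hM] := bop_bound T.
have h y : exists z, forall x, inner (T x) y = inner x z.
  apply: (@riesz R H (fun x => inner (T x) y) (M * `|y|)) => [k x x'|x].
    by rewrite linearP innerDl innerZl.
  rewrite (le_trans (inner_le _ _)) // mulrAC ler_wpM2r //.
have [S hS] := choice h.
have SlP : linear S.
  move=> k x y; apply: inner_ext => z; rewrite innerC [RHS]innerC; congr conjC.
  by rewrite -hS !(innerDr, innerZr) !hS.
have SbP : exists M : C, forall x, `|S x| <= M * `|x|.
  exists M => x; have [->|Sx] := eqVneq (S x) 0; first by rewrite normr0 mulr_ge0.
  rewrite -(ler_pM2r (x := `|S x|)) ?normr_gt0 // -expr2 normr_inner -hS.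
  rewrite -[leLHS]ger0_norm; last by rewrite hS -normr_inner exprn_ge0.
  rewrite (le_trans (inner_le _ _)) // mulrAC ler_wpM2r //.
by exists (Bop SlP SbP).
Qed.

Definition bop_adjoint T : B := projT1 (cid (bop_adjoint_exists T)).

Lemma adjointP T x y : inner (T x) y = inner x (bop_adjoint T y).
Proof. by rewrite /bop_adjoint; case: cid. Qed.

(* the least M >= 0 with |T x| <= M |x| for all x *)
Definition opnorm T : C :=
  (inf [set M : R | 0 <= M /\ forall x, `|T x| <= M%:C * `|x|])%:C.

Lemma opnorm_ge0 T : 0 <= opnorm T.
Proof.
rewrite /opnorm lecR; apply: lb_le_inf; last by move=> M [].
have [M M0 hM] := bop_bound T; exists (complex.Re M); split.
  by rewrite -lecR RRe_real // ger0_real.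
by move=> x; rewrite RRe_real // ger0_real.
Qed.

Lemma opnorm_min T (M : C) : 0 <= M -> (forall x, `|T x| <= M * `|x|) -> opnorm T <= M.
Proof.
move=> M0 hM; rewrite -(RRe_real (ger0_real M0)) lecR; apply: ge_inf.
  by exists 0 => r [].
split; first by rewrite -lecR RRe_real // ger0_real.
by move=> x; rewrite RRe_real // ger0_real.
Qed.

Lemma opnormP T x : `|T x| <= opnorm T * `|x|.
Proof.
have [->|x0] := eqVneq x 0; first by rewrite linear0 !normr0 mulr0.
have x0' : 0 < `|x| by rewrite normr_gt0.
rewrite -ler_pdivrMr //; set q := _ / _.
have q0 : 0 <= q by rewrite divr_ge0.
rewrite -(RRe_real (ger0_real q0)) lecR; apply: lb_le_inf.
  have [M M0 hM] := bop_bound T; exists (complex.Re M); split.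
    by rewrite -lecR RRe_real // ger0_real.
  by move=> y; rewrite RRe_real // ger0_real.
move=> M [M0 hM]; rewrite -lecR RRe_real ?ger0_real //.
by rewrite ler_pdivrMr.
Qed.

Lemma opnormD S T : opnorm (bop_add S T) <= opnorm S + opnorm T.
Proof.
apply: opnorm_min; first by rewrite addr_ge0 ?opnorm_ge0.
move=> x /=; rewrite mulrDl (le_trans (ler_normD _ _)) // lerD //; exact: opnormP.
Qed.

Lemma opnormM S T : opnorm (bop_comp S T) <= opnorm S * opnorm T.
Proof.
apply: opnorm_min; first by rewrite mulr_ge0 ?opnorm_ge0.
move=> x /=; rewrite (le_trans (opnormP _ _)) // -mulrA ler_wpM2l ?opnorm_ge0 //.
exact: opnormP.
Qed.

Lemma opnormZ k T : opnorm (bop_scale k T) = `|k| * opnorm T.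
Proof.
have h l S : opnorm (bop_scale l S) <= `|l| * opnorm S.
  apply: opnorm_min; first by rewrite mulr_ge0 ?opnorm_ge0.
  by move=> x /=; rewrite normrZ -mulrA ler_wpM2l // opnormP.
apply/eqP; rewrite eq_le h /=.
have [->|k0] := eqVneq k 0; first by rewrite normr0 mul0r opnorm_ge0.
rewrite -ler_pdivlMl ?normr_gt0 // -normfV (le_trans _ (h _ _)) //.
have -> // : bop_scale k^-1 (bop_scale k T) = T.
by apply: bop_ext => x /=; rewrite scalerA mulVf // scale1r.
Qed.

Lemma opnorm_eq0 T : opnorm T = 0 -> T = bop_zero.
Proof.
move=> T0; apply: bop_ext => x /=; apply/eqP; rewrite -normr_le0.
by rewrite (le_trans (opnormP _ _)) // T0 mul0r.
Qed.

Lemma opnorm_adjoint_le T : opnorm (bop_adjoint T) <= opnorm T.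
Proof.
apply: opnorm_min => [|x]; first exact: opnorm_ge0.
set S := bop_adjoint T.
have [->|Sx] := eqVneq (S x) 0; first by rewrite normr0 mulr_ge0 ?opnorm_ge0.
rewrite -(ler_pM2r (x := `|S x|)) ?normr_gt0 // -expr2 normr_inner -adjointP.
rewrite -[leLHS]ger0_norm; last by rewrite adjointP -normr_inner exprn_ge0.
by rewrite (le_trans (inner_le _ _)) // mulrAC ler_wpM2r // opnormP.
Qed.

HB.instance Definition _ := gen_eqMixin B.
HB.instance Definition _ := gen_choiceMixin B.

Fact bop_addA : associative bop_add.
Proof. by move=> S T U; apply: bop_ext => x /=; rewrite addrA. Qed.
Fact bop_addC : commutative bop_add.
Proof. by move=> S T; apply: bop_ext => x /=; rewrite addrC. Qed.
Fact bop_add0 : left_id bop_zero bop_add.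
Proof. by move=> S; apply: bop_ext => x /=; rewrite add0r. Qed.
Fact bop_addN : left_inverse bop_zero bop_opp bop_add.
Proof. by move=> S; apply: bop_ext => x /=; rewrite addNr. Qed.
HB.instance Definition _ :=
  GRing.isZmodule.Build B bop_addA bop_addC bop_add0 bop_addN.

Fact bop_scaleA k l T : bop_scale k (bop_scale l T) = bop_scale (k * l) T.
Proof. by apply: bop_ext => x /=; rewrite scalerA. Qed.
Fact bop_scale1 : left_id 1 bop_scale.
Proof. by move=> T; apply: bop_ext => x /=; rewrite scale1r. Qed.
Fact bop_scaleDr : right_distributive bop_scale +%R.
Proof. by move=> k S T; apply: bop_ext => x /=; rewrite scalerDr. Qed.
Fact bop_scaleDl T : {morph bop_scale^~ T : k l / k + l}.
Proof. by move=> k l; apply: bop_ext => x /=; rewrite scalerDl. Qed.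
HB.instance Definition _ :=
  GRing.Zmodule_isLmodule.Build C B bop_scaleA bop_scale1 bop_scaleDr bop_scaleDl.

HB.instance Definition _ :=
  Lmodule_isNormed.Build C B opnormD opnormZ opnorm_eq0.

Lemma bop_norm_le T x : `|T x| <= `|T| * `|x|.
Proof. exact: opnormP. Qed.

End bop_theory.

Section bop_complete.
Context {R : realType} {H : hilbertType R}.
Local Notation C := R[i].
Local Notation B := (bop H).
Implicit Types (S T : B) (x y : H) (k : C).

Lemma small_eq0 (V : normedModType C) (u : V) (b : C) : 0 <= b ->
  (forall e, 0 < e -> `|u| <= e * b) -> u = 0.
Proof.
move=> b0 h; apply/eqP; rewrite -normr_le0; apply/ler_addgt0Pr => e e0.
rewrite add0r; have b1 : 0 < b + 1 by rewrite ltr_wpDl.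
have := h (e / (b + 1)); rewrite divr_gt0 // => /(_ isT) /le_trans; apply.
by rewrite -mulrA ger_pMr // mulrC ler_pdivrMr // mul1r lerDl.
Qed.

Fact bop_complete (F : set_system B) : ProperFilter F -> cauchy F -> cvg F.
Proof.
move=> FF Fc.
have Fex e : 0 < e -> exists T0, F (ball T0 e).
  by move=> e0; have /cauchyP := Fc; apply.
have evc x : exists l : H, (fun T : B => T x) @ F --> l.
  exists (lim ((fun T : B => T x) @ F)); apply: cauchy_cvg; apply: cauchy_exP => e e0.
  have x1 : 0 < `|x| + 1 by rewrite ltr_wpDl.
  have [T0 FT0] := Fex _ (divr_gt0 e0 x1).
  exists (T0 x); suff : F ((fun T : B => T x) @^-1` ball (T0 x) e) by [].
  apply: filterS FT0 => T /=; rewrite -!ball_normE /ball_ /= => h.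
  have -> : T0 x - T x = (T0 - T) x by [].
  rewrite (le_lt_trans (bop_norm_le _ _)) //.
  rewrite (@le_lt_trans _ _ (e / (`|x| + 1) * `|x|)) //; first by rewrite ler_wpM2r // ltW.
  by rewrite mulrAC ltr_pdivrMr // ltr_pM2l // ltrDl.
have [l hl] := choice evc.
have lapp e T0 : F (ball T0 e) -> forall x, `|T0 x - l x| <= e * `|x|.
  move=> FT0 x; apply/ler_addgt0Pr => d d0.
  have Fd : F ((fun T : B => T x) @^-1` ball (l x) d) by apply: hl; exact: nbhsx_ballx.
  have [T [/=]] := filter_ex (filterI FT0 Fd); rewrite -!ball_normE /ball_ /= => h1 h2.
  rewrite -[T0 x](subrK (T x)) -addrA (le_trans (ler_normD _ _)) // lerD //.
    have -> : T0 x - T x = (T0 - T) x by [].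
    by rewrite (le_trans (bop_norm_le _ _)) // ler_wpM2r // ltW.
  by rewrite -normrN opprB ltW.
have llin : linear l.
  move=> k x y; apply/eqP; rewrite -subr_eq0; apply/eqP.
  apply: (@small_eq0 _ _ (`|k *: x + y| + (`|k| * `|x| + `|y|))) => [|e e0].
    by rewrite !addr_ge0 // mulr_ge0.
  have [T0 FT0] := Fex _ e0.
  have -> : l (k *: x + y) - (k *: l x + l y) =
      - (T0 (k *: x + y) - l (k *: x + y)) + (k *: (T0 x - l x) + (T0 y - l y)).
    have -> : T0 (k *: x + y) = k *: T0 x + T0 y by rewrite linearP.
    rewrite (scalerBr k (T0 x)) [X in _ = _ + X]addrACA -(opprD (k *: l x)).
    by rewrite opprB addrA subrK.
  rewrite (le_trans (ler_normD _ _)) // mulrDr lerD ?normrN ?lapp //.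
  rewrite (le_trans (ler_normD _ _)) // mulrDr lerD ?lapp //.
  by rewrite normrZ mulrCA ler_wpM2l ?lapp.
have lbd : exists M : C, forall x, `|l x| <= M * `|x|.
  have [T0 FT0] := Fex _ (ltr01 : 0 < (1 : C)).
  exists (`|T0| + 1) => x; rewrite -[l x](subKr (T0 x)) (le_trans (ler_normB _ _)) //.
  by rewrite mulrDl lerD ?lapp ?bop_norm_le.
apply/cvg_ex; exists (Bop llin lbd).
apply/cvg_ballP => e e0.
have e2 : 0 < e / 2 / 2 by rewrite !divr_gt0.
have [T0 FT0] := Fex _ e2.
apply: filterS (FT0) => T /=; rewrite -!ball_normE /ball_ /= => h.
rewrite -[Bop _ _](subrK T0) -addrA (le_lt_trans (ler_normD _ _)) //.
rewrite (@le_lt_trans _ _ (e / 2 / 2 + e / 2 / 2)) //.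
  rewrite lerD // ?(ltW h) //; apply: opnorm_min => [|x]; first exact: ltW.
  by rewrite -normrN /= opprB lapp.
by rewrite -splitr ltr_pdivrMr // ltr_pMr // ltr1n.
Qed.

HB.instance Definition _ := Uniform_isComplete.Build B bop_complete.

Lemma bopM_assoc : associative (@bop_comp R H).
Proof. by move=> S T U; apply: bop_ext. Qed.
Lemma bopM_Dl : left_distributive (@bop_comp R H) +%R.
Proof. by move=> S T U; apply: bop_ext. Qed.
Lemma bopM_Dr : right_distributive (@bop_comp R H) +%R.
Proof. by move=> S T U; apply: bop_ext => x /=; rewrite linearD. Qed.
Lemma bopM_Zl k S T : bop_comp (k *: S) T = k *: bop_comp S T.
Proof. exact: bop_ext. Qed.
Lemma bopM_Zr k S T : bop_comp S (k *: T) = k *: bop_comp S T.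
Proof. by apply: bop_ext => x /=; rewrite linearZ. Qed.
Lemma adjoint_unique S T : (forall x y, inner (S x) y = inner x (T y)) ->
  T = bop_adjoint S.
Proof.
move=> h; apply: bop_ext => y; apply: inner_ext => z.
by rewrite innerC -h adjointP -innerC.
Qed.
Lemma bop_adjointK : involutive (@bop_adjoint R H).
Proof.
move=> T; apply/esym/adjoint_unique => x y.
by rewrite innerC -adjointP -innerC.
Qed.
Lemma bop_adjointD : {morph @bop_adjoint R H : S T / S + T}.
Proof.
move=> S T; apply/esym/adjoint_unique => x y /=.
by rewrite innerDl innerDr !adjointP.
Qed.
Lemma bop_adjointZ k T : bop_adjoint (k *: T) = conjC k *: bop_adjoint T.
Proof.
apply/esym/adjoint_unique => x y /=.
by rewrite innerZl innerZr adjointP conjCK.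
Qed.
Lemma bop_adjointM S T :
  bop_adjoint (bop_comp S T) = bop_comp (bop_adjoint T) (bop_adjoint S).
Proof. by apply/esym/adjoint_unique => x y /=; rewrite !adjointP. Qed.
Lemma bop_cstar T : `|bop_comp (bop_adjoint T) T| = `|T| ^+ 2.
Proof.
apply/eqP; rewrite eq_le; apply/andP; split.
  rewrite (le_trans (opnormM _ _)) // expr2 ler_wpM2r ?opnorm_ge0 //.
  exact: opnorm_adjoint_le.
have s0 := normr_ge0 (bop_comp (bop_adjoint T) T).
have -> : `|bop_comp (bop_adjoint T) T| = sqrtC `|bop_comp (bop_adjoint T) T| ^+ 2.
  by rewrite sqrtCK.
rewrite ler_pXn2r ?nnegrE ?sqrtC_ge0 //.
apply: opnorm_min => [|x]; first by rewrite sqrtC_ge0.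
rewrite -(ler_pXn2r (n := 2)) ?nnegrE ?mulr_ge0 ?sqrtC_ge0 // exprMn sqrtCK.
rewrite normr_inner adjointP -[leLHS]ger0_norm; last by rewrite -adjointP -normr_inner exprn_ge0.
rewrite (le_trans (inner_le _ _)) // mulrC expr2 mulrA ler_wpM2r //.
exact: (bop_norm_le (bop_comp (bop_adjoint T) T)).
Qed.

HB.instance Definition _ := CompleteNormedModule_isCStarAlgebra.Build R B
  bopM_assoc bopM_Dl bopM_Dr bopM_Zl bopM_Zr bop_adjointK bop_adjointD
  bop_adjointZ bop_adjointM (@opnormM R H) bop_cstar.
End bop_complete.

Section exel.
Context {R : realType}.
Local Notation C := R[i].

Definition clspan {V : normedModType C} (X : set V) : set V :=
  closure [set v | exists n (c : 'I_n -> C) (u : 'I_n -> V),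
    (forall j, X (u j)) /\ v = \sum_(j < n) c j *: u j].

Record star_hom_on {A B : cstarAlgType R} (D : set A) (f : A -> B) : Prop := {
  star_homP : forall (k : C) a b, D a -> D b -> f (k *: a + b) = k *: f a + f b ;
  star_homM : forall a b, D a -> D b -> f (a ** b) = f a ** f b ;
  star_homS : forall a, D a -> f (star a) = star (f a)
}.

Definition star_hom {A B : cstarAlgType R} (f : A -> B) : Prop :=
  star_hom_on setT f.

Record cstar_subalg {A : cstarAlgType R} (D : set A) : Prop := {
  subalg_closed : closed D ;
  subalg_0 : D 0 ;
  subalg_P : forall (k : C) a b, D a -> D b -> D (k *: a + b) ;
  subalg_M : forall a b, D a -> D b -> D (a ** b) ;
  subalg_S : forall a, D a -> D (star a)
}.

Definition cstar_gen {A : cstarAlgType R} (X : set A) : set A :=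
  \bigcap_(D in [set D | cstar_subalg D /\ X `<=` D]) D.

Definition cstar_pos {A : cstarAlgType R} (a : A) : Prop :=
  exists b, a = star b ** b.

Record exel_system {A : cstarAlgType R} (alpha L : A -> A) : Prop := {
  exel_endo : star_hom alpha ;
  exel_linear : linear L ;
  exel_pos : forall a, cstar_pos a -> cstar_pos (L a) ;
  exel_transfer : forall a b, L (a ** alpha b) = L a ** b
}.

Definition nondegenerate {A : cstarAlgType R} {H : hilbertType R}
    (pi : A -> bop H) : Prop :=
  clspan [set h | exists a x, h = pi a x] = setT.

(* (pi, S) is a representation of (A, L) *)
Record rep_cp {A : cstarAlgType R} (L : A -> A) (H : hilbertType R)
    (pi : A -> bop H) (S : bop H) : Prop := {
  rep_cp_hom : star_hom pi ;
  rep_cp_nondeg : nondegenerate pi ;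
  rep_cpL : forall a, star S ** pi a ** S = pi (L a)
}.

(* (pi, S) is a representation of (A, alpha, L) *)
Record rep_exel {A : cstarAlgType R} (alpha L : A -> A) (H : hilbertType R)
    (pi : A -> bop H) (S : bop H) : Prop := {
  rep_exel_hom : star_hom pi ;
  rep_exel_nondeg : nondegenerate pi ;
  rep_exel_alpha : forall a, S ** pi a = pi (alpha a) ** S ;
  rep_exelL : forall a, star S ** pi a ** S = pi (L a)
}.

(* the redundancies (pi a, k) of (pi, S) as a representation of (A, L) *)
Definition redundancy_cp {A : cstarAlgType R} {H : hilbertType R}
    (pi : A -> bop H) (S : bop H) : set (bop H * bop H) :=
  [set p | exists a, [/\ p.1 = pi a,
    clspan [set T | exists b c d, T = pi b ** S ** pi c ** star S ** pi d] p.2 &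
    forall b, pi a ** pi b ** S = p.2 ** pi b ** S]].

(* the redundancies of (pi, S) as a representation of (A, alpha, L) *)
Definition redundancy_exel {A : cstarAlgType R} {H : hilbertType R}
    (pi : A -> bop H) (S : bop H) : set (bop H * bop H) :=
  [set p | exists a, [/\ p.1 = pi a,
    clspan [set T | exists b c, T = pi b ** S ** star S ** pi c] p.2 &
    forall b, pi a ** pi b ** S = p.2 ** pi b ** S]].

(* C*(pi(A) \cup pi(A)S) *)
Definition rep_alg {A : cstarAlgType R} {H : hilbertType R}
    (pi : A -> bop H) (S : bop H) : set (bop H) :=
  cstar_gen (range pi `|` range (fun a => pi a ** S)).

Record canonical_hom {A : cstarAlgType R} {U H : hilbertType R}
    (i : A -> bop U) (t : bop U) (pi : A -> bop H) (S : bop H)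
    (Phi : bop U -> bop H) : Prop := {
  canonical_star_hom : star_hom_on (rep_alg i t) Phi ;
  canonical_into : {homo Phi : x / rep_alg i t x >-> rep_alg pi S x} ;
  canonical_i : forall a, Phi (i a) = pi a ;
  canonical_it : forall a, Phi (i a ** t) = pi a ** S
}.

(* [P H pi S] says that (pi, S) is a representation on H of the kind P.
   (i, t) is universal for P if every (pi, S) of the kind P factors through
   C*(i(A) \cup i(A)t); Phi only matters on that algebra. *)
Definition universal_rep {A : cstarAlgType R}
    (P : forall H : hilbertType R, (A -> bop H) -> bop H -> Prop)
    (U : hilbertType R) (i : A -> bop U) (t : bop U) : Prop :=
  P U i t /\
  forall (H : hilbertType R) (pi : A -> bop H) (S : bop H), P H pi S ->
    exists2 Phi, canonical_hom i t pi S Phi &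
      forall Psi, canonical_hom i t pi S Psi ->
        forall x, rep_alg i t x -> Psi x = Phi x.

(* T is the Toeplitz algebra of P, realised on U by the universal
   representation (i, t) *)
Definition toeplitz {A : cstarAlgType R}
    (P : forall H : hilbertType R, (A -> bop H) -> bop H -> Prop)
    (U : hilbertType R) (i : A -> bop U) (t : bop U) (T : set (bop U)) : Prop :=
  universal_rep P i t /\ T = rep_alg i t.

End exel.

(* Main.v *)
(* The transfer identity gives S^* pi(c)^* (S pi(a) - pi(alpha(a)) S)
   = pi(L(c^* ) a - L(c^* alpha(a))) = 0, so v = S pi(a) h - pi(alpha(a)) S h is
   orthogonal to pi(A) S H.  Since pi(c^* c) v lies in pi(A) S H, pi(c) v = 0 for
   all c, and v = 0 by non-degeneracy.

   For the redundancies, the intertwining relation moves pi(c) across S, so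
   pi(A) S pi(A) S^* pi(A) is contained in pi(A) S S^* pi(A).  Conversely
   T = S^* pi(c) satisfies T T^* = pi(L(c c^* )) in pi(A), hence T is a norm limit
   of operators pi(a) T: T - (1 - s T T^* )^n T has this form and, for small s > 0,
   |(1 - s T T^* )^n T|^2 <= 1 / (n s). *)
Require Import Defs.
From mathcomp Require Import all_boot all_order all_algebra.
From mathcomp Require Import ring complex.
From mathcomp Require Import all_classical all_reals.
From mathcomp Require Import topology normedtype.

Set Implicit Arguments.
Unset Strict Implicit.
Unset Printing Implicit Defensive.

Import Order.TTheory GRing.Theory Num.Theory.
Local Open Scope classical_set_scope.
Local Open Scope ring_scope.

(** * Closed linear spans *)

Section closed_span.
Context {R : realType} {V : normedModType R[i]}.
Implicit Types (X Y : set V) (v w : V) (k e : R[i]).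

(** [clspan X] is [closure (span X)] by conversion. *)
Definition span X : set V :=
  [set v | exists n (c : 'I_n -> R[i]) (u : 'I_n -> V),
    (forall j, X (u j)) /\ v = \sum_(j < n) c j *: u j].

Lemma span_linear X k v w : span X v -> span X w -> span X (k *: v + w).
Proof.
move=> [m [c [u [Xu ->]]]] [n [d [z [Xz ->]]]].
exists (m + n)%N,
  (fun j : 'I_(m + n)%N =>
     match fintype.split j with inl a => k * c a | inr b => d b end),
  (fun j : 'I_(m + n)%N =>
     match fintype.split j with inl a => u a | inr b => z b end); split.
  by move=> j; case: fintype.split.
rewrite big_split_ord scaler_sumr; congr (_ + _); apply: eq_bigr => j _.
  by rewrite (unsplitK (inl j)) scalerA.
by rewrite (unsplitK (inr j)).
Qed.

Lemma span0 X : span X 0.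
Proof. by exists 0%N, (fun=> 0), (fun=> 0); split; [case | rewrite big_ord0]. Qed.

Lemma mem_span X v : X v -> span X v.
Proof.
by move=> Xv; exists 1%N, (fun=> 1), (fun=> v); split=> //; rewrite big_ord1 scale1r.
Qed.

Lemma clspanP X v :
  clspan X v <-> forall e, 0 < e -> exists2 w, span X w & `|v - w| < e.
Proof.
split=> [h e e0|h B /nbhs_ballP[e /= e0 eB]].
  have [w [Xw]] := h _ (nbhsx_ballx v e e0).
  by rewrite -ball_normE /ball_ /= => ?; exists w.
have [w Xw vw] := h e e0; exists w; split=> //; apply: eB.
by rewrite -ball_normE.
Qed.

Lemma clspan_linear X k v w : clspan X v -> clspan X w -> clspan X (k *: v + w).
Proof.
move=> /clspanP Xv /clspanP Xw; apply/clspanP => e e0.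
have k1 : 0 < `|k| + 1 by rewrite ltr_wpDl.
have e2 : 0 < e / 2 by rewrite divr_gt0.
have [v' Xv' vv'] := Xv _ (divr_gt0 e2 k1).
have [w' Xw' ww'] := Xw _ e2.
exists (k *: v' + w'); first exact: span_linear.
rewrite opprD addrACA -scalerBr (le_lt_trans (ler_normD _ _)) //.
rewrite [e]splitr ler_ltD // normrZ.
rewrite (le_trans (ler_wpM2l _ (ltW vv'))) // mulrCA ger_pMr //.
by rewrite ler_pdivrMr // mul1r lerDl.
Qed.

Lemma clspan_min X Y : X `<=` clspan Y -> clspan X `<=` clspan Y.
Proof.
move=> XY.
have clY : closed (clspan Y) by exact: closed_closure.
rewrite [X in _ `<=` X](closure_id _).1 //; apply: closure_subset.
move=> v [n [c [u [Xu ->]]]].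
apply: (big_ind (clspan Y)) => [|v' w'|j _].
- by apply: subset_closure; exact: span0.
- by move=> Yv' Yw'; rewrite -[v']scale1r; exact: clspan_linear.
- rewrite -[_ *: _]addr0; apply: clspan_linear; first exact: XY.
  by apply: subset_closure; exact: span0.
Qed.

End closed_span.

(** * Orthogonality and decay estimates in a Hilbert space *)

Section hilbert.
Context {R : realType} {H : hilbertType R}.
Implicit Types (T : bop H) (x y z : H).

Lemma inner_star T x y : inner (T x) y = inner x (star T y).
Proof. exact: adjointP. Qed.

Lemma orthogonal_total X x : clspan X = setT ->
  (forall y, X y -> inner x y = 0) -> x = 0.
Proof.
move=> Xtot xX.
have xspan w : span X w -> inner w x = 0.
  move=> [n [c [u [Xu ->]]]]; apply: (big_ind (fun w => inner w x = 0)).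
  - exact: inner0l.
  - by move=> a b a0 b0; rewrite innerDl a0 b0 addr0.
  - by move=> j _; rewrite innerZl innerC xX // rmorph0 mulr0.
have [//|x0] := eqVneq x 0.
have : clspan X x by rewrite Xtot.
move=> /clspanP xcl.
have xn : 0 < `|x| by rewrite normr_gt0.
(* Approximating [x] to within its own norm is enough: |x|^2 = (x - w, x) <= |x - w| |x| < |x|^2 is
   absurd. *)
have [w Xw xw] := xcl _ xn.
have : `|x| ^+ 2 <= `|x - w| * `|x|.
  rewrite normr_inner -[leLHS]ger0_norm; last by rewrite -normr_inner exprn_ge0.
  have -> : inner x x = inner (x - w) x by rewrite innerDl innerNl (xspan w) // subr0.
  exact: inner_le.
by rewrite expr2 ler_pM2r // => /(lt_le_trans xw); rewrite ltxx.
Qed.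

Lemma norm_star T : `|star T| <= `|T|.
Proof. exact: opnorm_adjoint_le. Qed.

(** The left side expands to |z|^2 - 2s |Tz|^2 + s^2 |T^*Tz|^2; since s |T|^2 <= 1, the last term
    absorbs only one of the two copies of s |Tz|^2. *)
Lemma norm_sub_gram T (s : R[i]) z : 0 <= s -> s * `|T| ^+ 2 <= 1 ->
  `|z - s *: star T (T z)| ^+ 2 <= `|z| ^+ 2 - s * `|T z| ^+ 2.
Proof.
move=> s0 sT.
have zz : inner z (star T (T z)) = `|T z| ^+ 2 by rewrite -inner_star normr_inner.
have zz' : inner (star T (T z)) z = `|T z| ^+ 2.
  by rewrite innerC zz geC0_conj // exprn_ge0.
rewrite [X in X <= _]normr_inner.
rewrite !(innerDl, innerDr, innerNl, innerNr, innerZl, innerZr) zz zz' -!normr_inner.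
rewrite geC0_conj //.
set a := `|T z| ^+ 2; set b := `|z| ^+ 2; set c := _ ^+ 2.
have ca : s * c <= a.
  have : c <= `|T| ^+ 2 * a.
    rewrite -exprMn lerXn2r ?nnegrE ?mulr_ge0 //.
    by rewrite (le_trans (bop_norm_le _ _)) // ler_wpM2r // norm_star.
  move=> /(ler_wpM2l s0) /le_trans; apply.
  by rewrite mulrA ler_piMl // exprn_ge0.
rewrite -subr_ge0.
have -> : b - s * a - (b - s * a + (- (s * a) - - (s * (s * c)))) = s * (a - s * c) by ring.
by rewrite mulr_ge0 // subr_ge0.
Qed.

Section damping.
Variables (T : bop H) (s : R[i]).
Hypotheses (s0 : 0 <= s) (sT : s * `|T| ^+ 2 <= 1).

(* (1 - s T T^* )^n T *)
Definition damped n : bop H := iter n (fun V => V - s *: (T ** star T ** V)) T.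

(* With z_n = (1 - s T^*T)^n z one has damped n z = T z_n, whose norm decreases,
   while s |T z_n|^2 <= |z_n|^2 - |z_(n+1)|^2 telescopes. *)
Lemma damped_bound n z : n%:R * s * `|damped n z| ^+ 2 <= `|z| ^+ 2.
Proof.
pose y m := iter m (fun w => w - s *: star T (T w)) z.
have TyS m : T (y m.+1) = T (y m) - s *: T (star T (T (y m))).
  by rewrite [y _]/= [LHS]linearB [X in _ - X = _]linearZ.
have dy m : damped m z = T (y m).
  by elim: m => // m IH; rewrite TyS -IH.
have mono m : `|T (y m.+1)| ^+ 2 <= `|T (y m)| ^+ 2.
  have := @norm_sub_gram (star T) s (T (y m)) s0.
  rewrite starK TyS => /(_ _)/le_trans; apply.
    by rewrite (le_trans _ sT) // ler_wpM2l // lerXn2r ?nnegrE ?norm_star.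
  by rewrite gerBl mulr_ge0 // exprn_ge0.
have : n%:R * s * `|damped n z| ^+ 2 <= `|z| ^+ 2 - `|y n| ^+ 2.
  rewrite dy; elim: n => [|n IH]; first by rewrite !mul0r subrr.
  rewrite (@le_trans _ _ (n.+1%:R * s * `|T (y n)| ^+ 2)) //.
    by rewrite ler_wpM2l // mulr_ge0.
  rewrite -natr1 2!mulrDl mul1r.
  have := norm_sub_gram (y n) s0 sT; rewrite lerBrDr -lerBrDl => /(lerD IH).
  by rewrite addrA subrK.
by move=> /le_trans; apply; rewrite gerBl exprn_ge0.
Qed.

End damping.
End hilbert.

(** * Approximate left units, intertwining and redundancies *)

Section star_hom_theory.
Context {R : realType} {A B : cstarAlgType R} {D : set A} {f : A -> B}.
Hypotheses (fhom : star_hom_on D f) (D0 : D 0).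

Lemma star_hom0 : f 0 = 0.
Proof. by have := star_homP fhom (-1) D0 D0; rewrite !scaleN1r !addNr. Qed.

End star_hom_theory.

Section representation.
Context {R : realType} {A : cstarAlgType R} {H : hilbertType R}.
Implicit Types (pi : A -> bop H) (S T : bop H) (e : R[i]).

Lemma damped_sub pi T l s n : star_hom pi -> T ** star T = pi l ->
  exists a, damped T s n = T - pi a ** T.
Proof.
move=> pihom Tl; elim: n => [|n [a IH]].
  exists 0; rewrite (star_hom0 pihom) //.
  by apply: bop_ext => x; rewrite /= subr0.
(* Read off from 1 - (1 - s l)(1 - a). *)
exists ((- s) *: (l ** a) + (s *: l + a)).
have pP k b c : pi (k *: b + c) = k *: pi b + pi c by rewrite (star_homP pihom).
rewrite /= -/(damped T s n) IH Tl !pP (star_homM pihom) //.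
apply: bop_ext => x /=.
have -> : pi l (T x - pi a (T x)) = pi l (T x) - pi l (pi a (T x)) by rewrite linearB.
rewrite scalerBr scaleNr !opprD !opprK addrACA.
rewrite -!addrA; congr (_ + _).
by rewrite addrC -!addrA addrCA; congr (_ + _); rewrite addrC.
Qed.

Lemma approx_left_unit pi T l e : star_hom pi -> T ** star T = pi l -> 0 < e ->
  exists a, `|T - pi a ** T| < e.
Proof.
move=> pihom Tl e0; pose s := (`|T| ^+ 2 + 1)^-1.
have T1 : 0 < `|T| ^+ 2 + 1 by rewrite ltr_wpDl // exprn_ge0.
have s0 : 0 < s by rewrite invr_gt0.
have sT : s * `|T| ^+ 2 <= 1 by rewrite mulrC ler_pdivrMr // mul1r lerDl.
pose d := e / 2; have d0 : 0 < d by rewrite divr_gt0.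
have sd : 0 < s * d ^+ 2 by rewrite mulr_gt0 // exprn_gt0.
(* The Archimedean property is used in [R]; [n] is chosen so that 1 / (n s) <= d^2, with d = e / 2
   to make the final bound strict. *)
pose r := complex.Re (s * d ^+ 2)^-1.
have rE : (s * d ^+ 2)^-1 = r%:C%C by rewrite RRe_real // gtr0_real // invr_gt0.
have [n rn] : exists n : nat, r <= n%:R.
  by exists (Num.bound r); rewrite ltW // archi_boundP // -lecR -rE ltW // invr_gt0.
have ns : 1 <= n%:R * s * d ^+ 2.
  rewrite -mulrA -ler_pdivrMr // mul1r rE.
  have -> : n%:R = (n%:R : R)%:C%C :> R[i] by rewrite rmorph_nat.
  by rewrite lecR.
have [a aE] := damped_sub s n pihom Tl.
exists a; rewrite -aE (@le_lt_trans _ _ d) //; last first.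
  by rewrite ltr_pdivrMr // ltr_pMr // ltr1n.
apply: opnorm_min => [|x]; first exact: ltW.
have d1 := ltW d0.
rewrite -(ler_pXn2r (n := 2)) ?nnegrE ?(mulr_ge0 d1) // exprMn.
have := ler_wpM2l (exprn_ge0 2 d1) (damped_bound (ltW s0) sT n x).
apply: le_trans; rewrite mulrA (mulrC (d ^+ 2)) ler_peMl // exprn_ge0 //.
Qed.

Lemma rep_cp_intertwines (alpha L : A -> A) pi S : exel_system alpha L ->
  rep_cp L pi S -> forall a, S ** pi a = pi (alpha a) ** S.
Proof.
move=> [_ _ _ LE] [pihom pind piL] a; apply: bop_ext => h /=.
have pM b c x : pi (b ** c) x = pi b (pi c x) by rewrite (star_homM pihom).
have pS b : star (pi b) = pi (star b) by rewrite (star_homS pihom).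
apply/eqP; rewrite -subr_eq0; apply/eqP.
set v := _ - _.
have piv c : pi c v = pi c (S (pi a h)) - pi (c ** alpha a) (S h).
  by rewrite pM linearB.
have vS c k : inner v (pi c (S k)) = 0.
  have -> : inner v (pi c (S k)) = inner (star S (pi (star c) v)) k.
    by rewrite !inner_star starK -pS starK.
  suff -> : star S (pi (star c) v) = 0 by rewrite inner0l.
  rewrite piv linearB /=.
  have LT b x : star S (pi b (S x)) = pi (L b) x by rewrite -piL.
  by rewrite !LT LE pM subrr.
(* |pi(c) v|^2 = (v, pi(c^* c) v), and pi(c^* c) v is a difference of two vectors of pi(A) S H. *)
have piv0 c : pi c v = 0.
  apply/eqP; rewrite -normr_eq0 -sqrf_eq0 normr_inner inner_star pS piv.
  by rewrite linearB /= -!pM innerDr innerNr !vS subrr.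
apply: (orthogonal_total pind) => _ [c [x ->]].
by rewrite -[pi c]starK pS -inner_star piv0 inner0l.
Qed.

Lemma rep_cp_exel (alpha L : A -> A) pi S : exel_system alpha L ->
  rep_cp L pi S <-> rep_exel alpha L pi S.
Proof.
move=> exel; split=> [rep|[pihom pind _ piL]]; last by split.
by case: (rep) => pihom pind piL; split=> //; exact: (rep_cp_intertwines exel rep).
Qed.

Lemma redundancy_cp_exel (alpha L : A -> A) pi S : exel_system alpha L ->
  rep_cp L pi S -> redundancy_cp pi S = redundancy_exel pi S.
Proof.
move=> exel rep; have inter := rep_cp_intertwines exel rep.
have [pihom _ piL] := rep.
have pM b c : pi (b ** c) = pi b ** pi c by rewrite (star_homM pihom).
have pS b : pi (star b) = star (pi b) by rewrite (star_homS pihom).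
suff span_eq : clspan [set T | exists b c d, T = pi b ** S ** pi c ** star S ** pi d] =
    clspan [set T | exists b c, T = pi b ** S ** star S ** pi c].
  by rewrite /redundancy_cp /redundancy_exel span_eq.
apply/seteqP; split; apply: clspan_min => T.
  move=> [b [c [d ->]]]; apply: subset_closure; apply: mem_span.
  by exists (b ** alpha c), d; rewrite -(cmulA (pi b)) inter cmulA pM.
move=> [b [c ->]]; apply/clspanP => e e0.
have bS : 0 < `|pi b ** S| + 1 by rewrite ltr_wpDl.
have Tl : (star S ** pi c) ** star (star S ** pi c) = pi (L (c ** star c)).
  by rewrite starM starK -piL pM pS !cmulA.
(* The left unit for S^* pi(c) supplies the factor pi(a) to insert between S and S^*. *)
have [a aT] := approx_left_unit pihom Tl (divr_gt0 e0 bS).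
exists (pi b ** S ** pi a ** star S ** pi c).
  by apply: mem_span; exists b, a, c.
have -> : pi b ** S ** star S ** pi c - pi b ** S ** pi a ** star S ** pi c =
    (pi b ** S) ** (star S ** pi c - pi a ** (star S ** pi c)).
  by rewrite cmulDr -[in RHS]scaleN1r cmulZr scaleN1r !cmulA.
rewrite (le_lt_trans (ler_cnormM _ _)) //.
rewrite (@le_lt_trans _ _ (`|pi b ** S| * (e / (`|pi b ** S| + 1)))) //.
  by rewrite ler_wpM2l // ltW.
by rewrite mulrA ltr_pdivrMr // mulrC ltr_pM2l // ltrDl.
Qed.

End representation.

(** * Uniqueness of universal representations *)

Section universal.
Context {R : realType} {A : cstarAlgType R}.

Lemma canonical_hom_id (U : hilbertType R) (i : A -> bop U) t :
  canonical_hom i t i t id.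
Proof. by split. Qed.

(** [Psi] respects the operations only on [rep_alg j s], where [Phi] takes its values by
    [canonical_into]. *)
Lemma canonical_hom_comp (U V W : hilbertType R) (i : A -> bop U) t
    (j : A -> bop V) s (k : A -> bop W) r Phi Psi :
  canonical_hom i t j s Phi -> canonical_hom j s k r Psi ->
  canonical_hom i t k r (Psi \o Phi).
Proof.
move=> [[PhiP PhiM PhiS] Phiin Phii Phit] [[PsiP PsiM PsiS] Psiin Psii Psit]; split.
- split=> [c a b ia ib|a b ia ib|a ia] /=.
  + by rewrite PhiP // PsiP //; exact: Phiin.
  + by rewrite PhiM // PsiM //; exact: Phiin.
  + by rewrite PhiS // PsiS //; exact: Phiin.
- by move=> x /Phiin /Psiin.
- by move=> a /=; rewrite Phii Psii.
- by move=> a /=; rewrite Phit Psit.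
Qed.

(** Each composite of the two canonical maps agrees with [id] on the generated algebra, by
    uniqueness. *)
Lemma universal_rep_iso P (U V : hilbertType R) (i : A -> bop U) t (j : A -> bop V) s :
  universal_rep P i t -> universal_rep P j s ->
  exists2 Phi, canonical_hom i t j s Phi & set_bij (rep_alg i t) (rep_alg j s) Phi.
Proof.
move=> [Pit univi] [Pjs univj].
have [Phi cPhi _] := univi _ _ _ Pjs; have [Psi cPsi _] := univj _ _ _ Pit.
have PhiK x : rep_alg i t x -> Psi (Phi x) = x.
  have [Id _ uniq] := univi _ _ _ Pit => ix.
  rewrite -[Psi _]/((Psi \o Phi) x) uniq //; last exact: canonical_hom_comp cPhi cPsi.
  by rewrite -(uniq id) //; exact: canonical_hom_id.
have PsiK y : rep_alg j s y -> Phi (Psi y) = y.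
  have [Id _ uniq] := univj _ _ _ Pjs => jy.
  rewrite -[Phi _]/((Phi \o Psi) y) uniq //; last exact: canonical_hom_comp cPsi cPhi.
  by rewrite -(uniq id) //; exact: canonical_hom_id.
exists Phi => //; split.
- exact: canonical_into cPhi.
- by move=> x y /set_mem ix /set_mem iy /(congr1 Psi); rewrite !PhiK.
- by move=> y jy; exists (Psi y); [exact: canonical_into cPsi _ jy | exact: PsiK].
Qed.

End universal.

Theorem proposition4p3 (R : realType) (A : cstarAlgType R) (alpha L : A -> A) :
  exel_system alpha L ->
  [/\ (* S pi(a) = pi(alpha(a)) S for every representation of (A, L) *)
      forall (H : hilbertType R) (pi : A -> bop H) (S : bop H),
        rep_cp L pi S -> forall a, S ** pi a = pi (alpha a) ** S,
      (* the classes of representations coincide *)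
      forall (H : hilbertType R) (pi : A -> bop H) (S : bop H),
        rep_cp L pi S <-> rep_exel alpha L pi S,
      (* T(A, L) = T(A, alpha, L): on the same Hilbert space ... *)
      forall (U : hilbertType R) (i : A -> bop U) (t : bop U) (T : set (bop U)),
        toeplitz (rep_cp L) i t T <-> toeplitz (rep_exel alpha L) i t T,
      (* ... and, for any choice of the universal representations, canonically *)
      forall (U V : hilbertType R) (i : A -> bop U) (t : bop U) (T : set (bop U))
          (j : A -> bop V) (s : bop V) (T' : set (bop V)),
        toeplitz (rep_cp L) i t T -> toeplitz (rep_exel alpha L) j s T' ->
        exists Phi : bop U -> bop V,
          [/\ star_hom_on T Phi, set_bij T T' Phi,
              forall a, Phi (i a) = j a &
              forall a, Phi (i a ** t) = j a ** s] &
      (* the notions of redundancy coincide *)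
      forall (H : hilbertType R) (pi : A -> bop H) (S : bop H),
        rep_cp L pi S -> redundancy_cp pi S = redundancy_exel pi S].
Proof.
move=> exel.
(* Extensionality turns the equivalence into an equality of predicates, which can be rewritten
   inside [toeplitz]. *)
have repE : @rep_cp R A L = @rep_exel R A alpha L.
  apply: functional_extensionality_dep => H; apply/funext => pi; apply/funext => S.
  by apply/propext; exact: rep_cp_exel.
split.
- by move=> H pi S; exact: rep_cp_intertwines.
- by move=> H pi S; exact: rep_cp_exel.
- by move=> U i t T; rewrite repE.
- move=> U V i t _ j s _ [univi ->] [univj ->]; rewrite -repE in univj.
  have [Phi [Phihom _ Phii Phit] Phibij] := universal_rep_iso univi univj.
  by exists Phi.
- by move=> H pi S; exact: (redundancy_cp_exel exel).
Qed.
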